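(* Assume the standing assumptions in the context. For the fixed-local-update scheme described in the context let $$\mathcal R^t:=\|\mathbf v^t\|^2+\|\mathbf v^t-\mathbf M\mathbf v^t\|^2+\|\mathbf x^t-\mathbf M\mathbf x^t\|^2 .$$ Fix the network and $K_c$, and choose the stepsize $\alpha=\bar\alpha/K_g$, where $\bar\alpha>0$ is sufficiently small and independent of $K_g$. Then there exists $c_0>0$, independent of $K_g$, such that the scheme satisfies, for all integers $T\ge1$, $$\min_{0\le t<T}\mathcal R^t\le\frac{P(\mathbf x^0,\mathbf v^0)-\underline F}{c_0T}.$$ Consequently, to obtain $\mathcal R^t\le\delta$ for some iterate $t$ (for a tolerance $\delta>0$), the total number of local gradient evaluations $\mathcal G_{\rm fix}(\delta)$ and the total number of communication rounds $\mathcal C_{\rm fix}(\delta)$ satisfy $$\mathcal G_{\rm fix}(\delta)=\mathcal O\left(\frac{nK_g}{\delta}\right),\qquad \mathcal C_{\rm fix}(\delta)=\mathcal O\left(\frac{K_c}{\delta}\right).$$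
   Context: Problem and standing assumptions. Let $f_1,\dots,f_n:\mathbb{R}^p\to\mathbb{R}$ be continuously differentiable (possibly nonconvex) and $F(\mathbf{z})=\frac1n\sum_{i=1}^n f_i(\mathbf{z})$. Assume: (i) $F$ is bounded below, $\underline F:=\inf_{\mathbf z}F(\mathbf z)>-\infty$; (ii) each $\nabla f_i$ is Lipschitz continuous with constant $L>0$; (iii) the communication graph $\mathcal{G}=(\{1,\dots,n\},\mathcal{E})$ is fixed, connected and undirected; $\mathcal{N}_i$ denotes the set of neighbors of $i$, including $i$ itself. Mixing matrix. $\tilde{\mathbf W}=[\tilde W_{ij}]\in\mathbb{R}^{n\times n}$ is symmetric, doubly stochastic, with $\tilde W_{ij}>0$ if $j\in\mathcal N_i$ and $\tilde W_{ij}=0$ otherwise. $\mathbf W=\tilde{\mathbf W}\otimes\mathbf I_p$, $\mathbf M=\frac1n\mathbf 1_n\mathbf 1_n^{\sf T}\otimes\mathbf I_p$, and $\sigma$ is the second largest eigenvalue magnitude of $\tilde{\mathbf W}$; it is assumed that $0<\sigma<1$. Notation. For $\mathbf u_1,\dots,\mathbf u_n\in\mathbb R^p$, $\mathbf u=[\mathbf u_1;\dots;\mathbf u_n]\in\mathbb R^{np}$ and $\bar{\mathbf u}=\frac1n\sum_i\mathbf u_i$. $\|\cdot\|$ is the Euclidean norm. Fixed-local-update scheme (integers $K_g,K_c\ge1$, stepsize $\alpha>0$). Initialize $\mathbf x^0$ and $\mathbf v_i^0=\nabla f_i(\mathbf x_i^0)$. All scaling matrices $\mathbf H_i^{t,k}\in\mathbb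 R^{p\times p}$ are symmetric with $\psi\mathbf I_p\preceq\mathbf H_i^{t,k}\preceq\Psi\mathbf I_p$ for fixed constants $0<\psi\le\Psi$ (independent of $K_g$). At outer iteration $t$, with $\mathbf x_i^{t,0}=\mathbf x_i^t$, $\mathbf v_i^{t,0}=\mathbf v_i^t$: for $k=0,\dots,K_g-2$, $\mathbf x_i^{t,k+1}=\mathbf x_i^{t,k}-\alpha\mathbf H_i^{t,k}\mathbf v_i^{t,k}$ and $\mathbf v_i^{t,k+1}=\mathbf v_i^{t,k}+\nabla f_i(\mathbf x_i^{t,k+1})-\nabla f_i(\mathbf x_i^{t,k})$; then $\mathbf x_i^{t,K_g}=\mathbf x_i^{t,K_g-1}-\alpha\mathbf H_i^{t,K_g-1}\mathbf v_i^{t,K_g-1}$, $\mathbf x^{t+1}=\mathbf W^{K_c}\mathbf x^{t,K_g}$, $\mathbf v_i^{t,K_g}=\mathbf v_i^{t,K_g-1}+\nabla f_i(\mathbf x_i^{t+1})-\nabla f_i(\mathbf x_i^{t,K_g-1})$, $\mathbf v^{t+1}=\mathbf W^{K_c}\mathbf v^{t,K_g}$. Counting convention: each outer iteration costs $K_g$ local gradient evaluations at every node and $K_c$ communication rounds. Potential function: $$P(\mathbf{x}^t,\mathbf{v}^t)=F(\bar{\mathbf{x}}^t)+\|\mathbf{x}^t-\mathbf{M}\mathbf{x}^t\|^2+\frac{(1-\sigma^{2K_c})^2}{16(1+\sigma^{2K_c})L^2}\|\mathbf{v}^t-\mathbf{M}\mathbf{v}^t\|^2 .$$ ''$\bar\alpha$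 sufficiently small and independent of $K_g$'' means $0<\bar\alpha\le\bar\alpha_{\max}$ for some threshold depending only on $L,n,\sigma,K_c,\psi,\Psi$; the constants hidden in $\mathcal O$ do not depend on $K_g$ or $\delta$. *)

(* Defs.v *)
From mathcomp Require Import all_boot all_order all_algebra.
From mathcomp Require Import mxtens.
From mathcomp Require Import all_classical all_reals all_analysis.

Set Implicit Arguments.
Unset Strict Implicit.
Unset Printing Implicit Defensive.

Import Order.TTheory GRing.Theory Num.Theory.
Import numFieldNormedType.Exports.

Local Open Scope classical_set_scope.
Local Open Scope ring_scope.

(* The library norm on matrices is the sup norm, hence a separate definition. *)
Definition enorm (R : realType) (m : nat) (u : 'cV[R]_m) : R :=
  Num.sqrt (\sum_(i < m) u i 0 ^+ 2).

Definition grad (R : realType) (p : nat) (f : 'cV[R]_p -> R) (z : 'cV[R]_p) :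
    'cV[R]_p :=
  \col_j 'D_(delta_mx j 0) f z.

Definition C1 (R : realType) (p : nat) (f : 'cV[R]_p -> R) : Prop :=
  (forall z, differentiable f z) /\ continuous (grad f).

Definition grad_lipschitz (R : realType) (p : nat) (L : R)
    (f : 'cV[R]_p -> R) : Prop :=
  forall y z, enorm (grad f y - grad f z) <= L * enorm (y - z).

Definition objective (R : realType) (n p : nat) (f : 'I_n -> 'cV[R]_p -> R)
    (z : 'cV[R]_p) : R :=
  n%:R^-1 * \sum_(i < n) f i z.

Definition nbh (n : nat) (e : rel 'I_n) (i j : 'I_n) : bool := (j == i) || e i j.

Definition connected_graph (n : nat) (e : rel 'I_n) : Prop :=
  symmetric e /\ forall i j, connect e i j.

Definition doubly_stochastic (R : realType) (n : nat) (A : 'M[R]_n) : Prop :=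
  [/\ forall i j, 0 <= A i j,
      forall i, \sum_j A i j = 1 &
      forall j, \sum_i A i j = 1].

Definition mixing_matrix (R : realType) (n : nat) (e : rel 'I_n)
    (Wt : 'M[R]_n) : Prop :=
  [/\ Wt^T = Wt, doubly_stochastic Wt &
      forall i j, (nbh e i j -> 0 < Wt i j) /\ (~~ nbh e i j -> Wt i j = 0)].

(* [s] lists the eigenvalues of [A] with multiplicity, by decreasing modulus;
   the condition [1 < size s] excludes n <= 1, where there is no second one. *)
Definition second_eigenvalue_magnitude (R : realType) (n : nat) (A : 'M[R]_n)
    (sigma : R) : Prop :=
  exists s : seq R,
    [/\ char_poly A = \prod_(a <- s) ('X - a%:P),
        sorted (fun a b => `|b| <= `|a|) s,
        (1 < size s)%N & sigma = `|s`_1| ].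

(* Stacked vectors [u_1; ...; u_n] of R^(np): [mxtens_index (i, j)] is the
   position i * p + j, which is also the indexing of the Kronecker product
   [_ *t _]. *)
Definition block (R : realType) (n p : nat) (u : 'cV[R]_(n * p)) (i : 'I_n) :
    'cV[R]_p :=
  \col_j u (mxtens_index (i, j)) 0.

Definition mean (R : realType) (n p : nat) (u : 'cV[R]_(n * p)) : 'cV[R]_p :=
  n%:R^-1 *: \sum_(i < n) block u i.

Definition Wmx (R : realType) (n p : nat) (Wt : 'M[R]_n) : 'M[R]_(n * p) :=
  Wt *t (1%:M : 'M[R]_p).

Definition Mmx (R : realType) (n p : nat) : 'M[R]_(n * p) :=
  (n%:R^-1 *: ((const_mx 1 : 'cV[R]_n) *m (const_mx 1 : 'cV[R]_n)^T))
    *t (1%:M : 'M[R]_p).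

Definition loewner_le (R : realType) (p : nat) (A B : 'M[R]_p) : Prop :=
  forall u : 'cV[R]_p, 0 <= (u^T *m (B - A) *m u) 0 0.

Definition scaling_matrix (R : realType) (p : nat) (psi Psi : R)
    (H : 'M[R]_p) : Prop :=
  [/\ H^T = H, loewner_le psi%:M H & loewner_le H Psi%:M].

(* [xl t k], [vl t k] are the inner iterates x^{t,k}, v^{t,k}. *)
Record fixed_update_run (R : realType) (n p : nat)
    (f : 'I_n -> 'cV[R]_p -> R) (Wt : 'M[R]_n) (Kg Kc : nat) (alpha : R)
    (H : nat -> nat -> 'I_n -> 'M[R]_p) (x0 : 'cV[R]_(n * p))
    (x v : nat -> 'cV[R]_(n * p)) (xl vl : nat -> nat -> 'cV[R]_(n * p)) :
    Prop := FixedUpdateRun {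
  run_x0 : x 0%N = x0;
  run_v0 : forall i, block (v 0%N) i = grad (f i) (block (x 0%N) i);
  run_xl0 : forall t, xl t 0%N = x t;
  run_vl0 : forall t, vl t 0%N = v t;
  run_xl : forall t k i, (k < Kg)%N ->
    block (xl t k.+1) i =
      block (xl t k) i - alpha *: (H t k i *m block (vl t k) i);
  run_vl : forall t k i, (k < Kg.-1)%N ->
    block (vl t k.+1) i =
      block (vl t k) i + grad (f i) (block (xl t k.+1) i)
                       - grad (f i) (block (xl t k) i);
  run_x : forall t, x t.+1 = Wmx p Wt ^+ Kc *m xl t Kg;
  run_vlK : forall t i,
    block (vl t Kg) i =
      block (vl t Kg.-1) i + grad (f i) (block (x t.+1) i)
                           - grad (f i) (block (xl t Kg.-1) i);
  run_v : forall t, v t.+1 = Wmx p Wt ^+ Kc *m vl t Kg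
}.

Definition potential (R : realType) (n p : nat) (f : 'I_n -> 'cV[R]_p -> R)
    (L sigma : R) (Kc : nat) (x v : 'cV[R]_(n * p)) : R :=
  objective f (mean x) + enorm (x - Mmx R n p *m x) ^+ 2
  + (1 - sigma ^+ (2 * Kc)) ^+ 2 / (16 * (1 + sigma ^+ (2 * Kc)) * L ^+ 2)
    * enorm (v - Mmx R n p *m v) ^+ 2.

Definition residual (R : realType) (n p : nat) (x v : 'cV[R]_(n * p)) : R :=
  enorm v ^+ 2 + enorm (v - Mmx R n p *m v) ^+ 2
  + enorm (x - Mmx R n p *m x) ^+ 2.

(* [N] outer iterations have been executed when the iterate of index [N] is
   available. *)
Definition first_reach (R : realType) (r : nat -> R) (delta : R) (N : nat) :
    Prop :=
  r N <= delta /\ forall t, (t < N)%N -> delta < r t.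

Definition gradient_evaluations (n Kg N : nat) : nat := (N * (n * Kg))%N.
Definition communication_rounds (Kc N : nat) : nat := (N * Kc)%N.

(* Main.v *)
(* Writing s = sigma^(2 Kc) and viewing stacked vectors as n x p matrices, one
   outer iteration reads X' = W^Kc (X - S), V' = W^Kc (V + G(X') - G(X)), where
   S collects the Kg scaled local steps and G the local gradients.  Local
   gradient tracking keeps every inner direction within relative distance
   O(abar) of V, so |S| <= 2 abar Psi |V| and <V, S> >= (abar psi / 2) |V|^2
   uniformly in Kg.  Since mixing preserves averages, the mean of V is the mean
   of G(X); hence the descent lemma makes F(mean X) decrease by order
   abar |V|^2, up to O(abar) times the two consensus errors.  Those errors
   contract by (1 + s) / 2 per iteration up to terms in |S|^2 = O(abar^2 |V|^2),
   and the weight of the second one in P absorbs the coupling term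
   s (1 - s) / 2 |X - M X|^2.  For small abar this gives
   P^(t+1) + c0 R^t <= P^t, and the bounds follow by telescoping. *)

Require Import Defs.
From mathcomp Require Import all_boot all_order all_algebra.
From mathcomp Require Import ring lra mxtens.
From mathcomp Require Import all_classical all_reals all_analysis.

Import Order.TTheory GRing.Theory Num.Theory.
Import numFieldNormedType.Exports.

Local Open Scope classical_set_scope.
Local Open Scope ring_scope.

Set Implicit Arguments.
Unset Strict Implicit.
Unset Printing Implicit Defensive.

(** * Frobenius inner product and squared norm *)

Definition dot (R : realType) m n (A B : 'M[R]_(m, n)) : R := \tr (A^T *m B).

Definition nsq (R : realType) m n (A : 'M[R]_(m, n)) : R := dot A A.

Section Dot.
Variables (R : realType) (m n : nat).
Implicit Types (A B C : 'M[R]_(m, n)) (a : R).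

Lemma dotE A B : dot A B = \sum_i \sum_j A i j * B i j.
Proof.
rewrite /dot /mxtrace exchange_big; apply: eq_bigr => j _.
by rewrite mxE; apply: eq_bigr => i _; rewrite mxE.
Qed.

Lemma dotC A B : dot A B = dot B A.
Proof. by rewrite /dot -mxtrace_tr trmx_mul trmxK. Qed.

Lemma dotDl A B C : dot (A + B) C = dot A C + dot B C.
Proof. by rewrite /dot linearD mulmxDl linearD. Qed.

Lemma dotDr A B C : dot A (B + C) = dot A B + dot A C.
Proof. by rewrite /dot mulmxDr linearD. Qed.

Lemma dotZl a A B : dot (a *: A) B = a * dot A B.
Proof. by rewrite /dot linearZ -scalemxAl linearZ. Qed.

Lemma dotZr a A B : dot A (a *: B) = a * dot A B.
Proof. by rewrite dotC dotZl dotC. Qed.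

Lemma dotNl A B : dot (- A) B = - dot A B.
Proof. by rewrite -scaleN1r dotZl mulN1r. Qed.

Lemma dotNr A B : dot A (- B) = - dot A B.
Proof. by rewrite dotC dotNl dotC. Qed.

Lemma dot0r A : dot A 0 = 0.
Proof. by rewrite -(scale0r 0) dotZr mul0r. Qed.

Lemma dot_mulmxl k (C : 'M[R]_(m, k)) (A : 'M[R]_(k, n)) B :
  dot (C *m A) B = dot A (C^T *m B).
Proof. by rewrite /dot trmx_mul mulmxA. Qed.

Lemma nsqE A : nsq A = \sum_i \sum_j A i j ^+ 2.
Proof. by rewrite /nsq dotE. Qed.

Lemma nsq_ge0 A : 0 <= nsq A.
Proof.
by rewrite nsqE; apply: sumr_ge0 => i _; apply: sumr_ge0 => j _; exact: sqr_ge0.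
Qed.

Lemma nsq_eq0 A : (nsq A == 0) = (A == 0).
Proof.
apply/eqP/eqP => [|->]; last by rewrite /nsq dot0r.
rewrite nsqE => /eqP; rewrite psumr_eq0; last first.
  by move=> i _; apply: sumr_ge0 => j _; exact: sqr_ge0.
move=> /allP A0; apply/matrixP => i j; rewrite mxE.
have := A0 i (mem_index_enum i); rewrite psumr_eq0 /=; last first.
  by move=> k _; exact: sqr_ge0.
by move=> /allP/(_ j (mem_index_enum j)); rewrite /= sqrf_eq0 => /eqP.
Qed.

Lemma nsq0 : nsq (0 : 'M[R]_(m, n)) = 0.
Proof. by apply/eqP; rewrite nsq_eq0. Qed.

Lemma nsqD A B : nsq (A + B) = nsq A + 2 * dot A B + nsq B.
Proof. by rewrite /nsq !dotDl !dotDr (dotC B A); ring. Qed.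

Lemma nsqN A : nsq (- A) = nsq A.
Proof. by rewrite /nsq dotNl dotNr opprK. Qed.

Lemma nsqB A B : nsq (A - B) = nsq A - 2 * dot A B + nsq B.
Proof. by rewrite nsqD nsqN dotNr; ring. Qed.

Lemma nsqZ a A : nsq (a *: A) = a ^+ 2 * nsq A.
Proof. by rewrite /nsq dotZl dotZr; ring. Qed.

(** Expand the square of [A - (2 * tau)^-1 *: B]. In [one_step] the free [tau] balances what a cross
    term charges to the consensus errors against what it charges to the local step. *)
Lemma young (tau : R) A B : 0 < tau ->
  dot A B <= tau * nsq A + (4 * tau)^-1 * nsq B.
Proof.
move=> tau0; have := nsq_ge0 (A - (2 * tau)^-1 *: B).
rewrite nsqB nsqZ dotZr => h; rewrite -(ler_pM2l (x := tau^-1)) ?invr_gt0//.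
apply: le_trans (_ : nsq A + (2 * tau)^-1 ^+ 2 * nsq B <= _).
  have -> : tau^-1 * dot A B = 2 * ((2 * tau)^-1 * dot A B).
    by rewrite invfM; field; rewrite gt_eqF.
  by lra.
by rewrite le_eqVlt; apply/orP; left; apply/eqP; field; rewrite gt_eqF.
Qed.

Lemma nsqD_le (eta : R) A B : 0 < eta ->
  nsq (A + B) <= (1 + eta) * nsq A + (1 + eta^-1) * nsq B.
Proof.
move=> eta0; have e2 : 0 < eta / 2 by rewrite divr_gt0.
have := young A B e2; rewrite nsqD.
have -> : (4 * (eta / 2))^-1 = eta^-1 / 2 by field; rewrite gt_eqF.
by lra.
Qed.

End Dot.

Lemma nsq_col (R : realType) m n (A : 'M[R]_(m, n)) : nsq A = \sum_j nsq (col j A).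
Proof.
rewrite nsqE exchange_big; apply: eq_bigr => j _; rewrite nsqE.
by apply: eq_bigr => i _; rewrite big_ord1 mxE.
Qed.

Lemma dot_row (R : realType) m n (A B : 'M[R]_(m, n)) :
  dot A B = \sum_i dot (row i A)^T (row i B)^T.
Proof.
rewrite dotE; apply: eq_bigr => i _; rewrite dotE.
by apply: eq_bigr => j _; rewrite big_ord1 !mxE.
Qed.

(** * Euclidean norm and Cauchy-Schwarz inequalities *)

Section Norms.
Variables (R : realType) (m : nat).
Implicit Types (u v : 'cV[R]_m) (B : 'M[R]_m).

Lemma enorm_sqr u : enorm u ^+ 2 = nsq u.
Proof.
rewrite sqr_sqrtr; last by apply: sumr_ge0 => i _; exact: sqr_ge0.
by rewrite nsqE; apply: eq_bigr => i _; rewrite big_ord1.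
Qed.

Lemma enorm_ge0 u : 0 <= enorm u.
Proof. exact: sqrtr_ge0. Qed.

(** The degenerate case [c = 0] is included because the forms it is applied to may be only
    semidefinite; [b] then has to vanish. *)
Lemma quadratic_ge0_discr (a b c : R) : 0 <= c ->
  (forall t, 0 <= a + 2 * t * b + t ^+ 2 * c) -> b ^+ 2 <= a * c.
Proof.
rewrite le_eqVlt => /predU1P[<- h|c0 h].
  have [->|b0] := eqVneq b 0; first by rewrite expr0n mulr0.
  (* An affine function of nonzero slope takes the value -1 at this point. *)
  have := h (- (a + 1) / (2 * b)).
  have -> : a + 2 * (- (a + 1) / (2 * b)) * b + (- (a + 1) / (2 * b)) ^+ 2 * 0
            = -1 by field.
  by lra.
have := h (- b / c).
have -> : a + 2 * (- b / c) * b + (- b / c) ^+ 2 * c = a - b ^+ 2 / c.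
  by field; rewrite gt_eqF.
by rewrite subr_ge0 ler_pdivrMr.
Qed.

(** The form is nonnegative along [u + t *: v], which is a quadratic in [t]. It is used with [B] the
    identity, [mu - A^2], and a scaling matrix. *)
Lemma psd_cauchy_schwarz B u v : B^T = B ->
  (forall w : 'cV_m, 0 <= dot w (B *m w)) ->
  dot u (B *m v) ^+ 2 <= dot u (B *m u) * dot v (B *m v).
Proof.
move=> Bsym Bpos; apply: quadratic_ge0_discr => // t.
have := Bpos (u + t *: v); rewrite mulmxDr -scalemxAr !dotDl !dotDr.
rewrite !dotZl !dotZr.
have -> : dot v (B *m u) = dot u (B *m v) by rewrite dotC dot_mulmxl Bsym.
by congr (_ <= _); ring.
Qed.

Lemma cauchy_schwarz u v : dot u v <= enorm u * enorm v.
Proof.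
apply: le_trans (ler_norm _) _.
rewrite -(@ler_pXn2r _ 2) ?nnegrE ?mulr_ge0 ?enorm_ge0//.
rewrite real_normK ?num_real// exprMn !enorm_sqr.
have /= := @psd_cauchy_schwarz 1%:M u v (trmx1 _ _); rewrite !mul1mx.
by apply=> w; rewrite mul1mx; exact: nsq_ge0.
Qed.

Lemma enormD u v : enorm (u + v) <= enorm u + enorm v.
Proof.
rewrite -(@ler_pXn2r _ 2) ?nnegrE ?addr_ge0 ?enorm_ge0// sqrrD !enorm_sqr nsqD.
by have := cauchy_schwarz u v; lra.
Qed.

Lemma enormZ (a : R) u : enorm (a *: u) = `|a| * enorm u.
Proof.
apply/eqP; rewrite -(@eqrXn2 _ 2) ?mulr_ge0 ?enorm_ge0//.
by rewrite exprMn !enorm_sqr nsqZ real_normK ?num_real.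
Qed.

End Norms.

(** Cauchy-Schwarz on each row. In [symmetric_norm_attained] this makes the set of admissible
    operator bounds nonempty and controls an inverse matrix. *)
Lemma nsq_mulmx_le (R : realType) m n (A : 'M[R]_(m, n)) (u : 'cV[R]_n) :
  nsq (A *m u) <= nsq A * nsq u.
Proof.
rewrite {1}nsqE [nsq A]/nsq dot_row mulr_suml.
apply: ler_sum => i _; rewrite big_ord1.
have -> : (A *m u) i 0 = dot (row i A)^T u.
  rewrite mxE dotE; apply: eq_bigr => j _.
  by rewrite big_ord1 !mxE.
rewrite -[dot (row i A)^T (row i A)^T]/(nsq _) -!enorm_sqr -exprMn.
rewrite -[X in X <= _]real_normK ?num_real// ler_pXn2r ?nnegrE//;
  last by rewrite mulr_ge0 ?enorm_ge0.
rewrite ler_norml cauchy_schwarz andbT lerNl -dotNl.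
apply: le_trans (cauchy_schwarz _ _) _.
by rewrite -scaleN1r enormZ normrN1 mul1r.
Qed.

(** * Operator norm of a symmetric matrix through its eigenvalues *)

Section SymmetricOperatorNorm.
Variables (R : realType) (n : nat) (A : 'M[R]_n).
Hypothesis Asym : A^T = A.

(* [mu - A^2] is singular for the optimal constant [mu] in
   [|A u|^2 <= mu |u|^2]; otherwise it would be bounded below by a positive
   multiple of the identity, and [mu] could be decreased. *)
Lemma symmetric_norm_attained : (0 < n)%N ->
  exists2 mu, forall u : 'cV[R]_n, nsq (A *m u) <= mu * nsq u &
  exists2 w : 'cV[R]_n, w != 0 & A *m (A *m w) = mu *: w.
Proof.
move=> n0; pose S := [set mu : R | forall u : 'cV[R]_n, nsq (A *m u) <= mu * nsq u].
have SA : S (nsq A) by move=> u; exact: nsq_mulmx_le.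
have Slb : lbound S 0.
  move=> mu Smu; pose u := delta_mx (Ordinal n0) 0 : 'cV[R]_n.
  have u0 : 0 < nsq u.
    rewrite lt_neqAle nsq_ge0 andbT eq_sym nsq_eq0.
    by apply/eqP => /matrixP/(_ (Ordinal n0) 0)/eqP; rewrite !mxE !eqxx oner_eq0.
  rewrite -(pmulr_lge0 _ u0); exact: le_trans (nsq_ge0 _) (Smu u).
pose mu := inf S.
have Smu : S mu.
  move=> u; have [u0|u0] := leP (nsq u) 0.
    have : u == 0 by rewrite -nsq_eq0 eq_le u0 nsq_ge0.
    by move=> /eqP->; rewrite mulmx0 !nsq0 mulr0.
  rewrite -ler_pdivrMr//; apply: lb_le_inf; first by exists (nsq A).
  by move=> a Sa; rewrite ler_pdivrMr//; exact: Sa.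
exists mu => //; pose B := mu%:M - A *m A.
have Bu (u : 'cV[R]_n) : B *m u = mu *: u - A *m (A *m u).
  by rewrite mulmxBl mul_scalar_mx mulmxA.
have Bdot (u : 'cV[R]_n) : dot u (B *m u) = mu * nsq u - nsq (A *m u).
  by rewrite Bu dotDr dotNr dotZr -{1}Asym -dot_mulmxl.
have Bsym : B^T = B by rewrite linearB /= tr_scalar_mx trmx_mul Asym.
have Bpos (u : 'cV[R]_n) : 0 <= dot u (B *m u) by rewrite Bdot subr_ge0; exact: Smu.
(* A singular [B] has a left null vector, which by symmetry is a right one, that is, the wanted
   eigenvector of [A^2]. *)
have [Bunit|/negbTE Bsing] := boolP (B \in unitmx); last first.
  have /det0P[v v0 vB] : \det B == 0.
    by move: Bsing; rewrite unitmxE unitfE => /negbT; rewrite negbK.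
  exists v^T; first by rewrite -(trmx0 _) (inj_eq trmx_inj).
  have : B *m v^T = 0 by rewrite -Bsym -trmx_mul vB trmx0.
  by rewrite Bu => /eqP; rewrite subr_eq0 => /eqP <-.
pose D := (nsq (invmx B) + 1) / 2.
have D0 : 0 < D by rewrite divr_gt0// ltr_wpDl ?nsq_ge0.
(* Cauchy-Schwarz in the form [B] for [u] and B^-1 u gives |u|^4 <= <u, B u> <B^-1 u, u>, and Young
   bounds the last factor by D |u|^2. *)
have BD (u : 'cV[R]_n) : nsq u <= D * dot u (B *m u).
  have [u0|u0] := leP (nsq u) 0.
    by rewrite (le_trans u0)// mulr_ge0// ltW.
  have := psd_cauchy_schwarz u (invmx B *m u) Bsym Bpos.
  rewrite mulmxA mulmxV// mul1mx -/(nsq u) => h.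
  have h1 : dot (invmx B *m u) u <= D * nsq u.
    have := @young _ _ _ (1 / 2) (invmx B *m u) u; rewrite divr_gt0// => /(_ isT).
    have := nsq_mulmx_le (invmx B) u.
    have -> : (4 * (1 / 2))^-1 = 1 / 2 :> R by field.
    by rewrite /D; lra.
  have := le_trans h (ler_wpM2l (Bpos u) h1).
  by rewrite expr2 mulrA ler_pM2r// [dot _ _ * D]mulrC.
(* By [BD], [mu - D^-1] is still an admissible bound, against the minimality of [mu]. *)
have : mu <= mu - D^-1.
  apply: ge_inf; first by exists 0.
  move=> u; have := BD u; rewrite Bdot mulrBl -(ler_pM2l (x := D^-1)) ?invr_gt0//.
  by rewrite mulrA mulVf ?gt_eqF// mul1r; lra.
by rewrite lerBrDl gerDr leNgt invr_gt0 D0.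
Qed.

(** With r^2 = mu, the vector [w] satisfies (A - r)(A + r) w = 0: either A w = -r w, or A w + r w is
    an eigenvector for r. Both ways r is the modulus of an eigenvalue. *)
Lemma symmetric_norm_le_eigenvalue (sigma : R) : 0 <= sigma ->
  (forall a (w : 'cV[R]_n), w != 0 -> A *m w = a *: w -> `|a| <= sigma) ->
  forall k (X : 'M[R]_(n, k)), nsq (A *m X) <= sigma ^+ 2 * nsq X.
Proof.
move=> sigma0 eig k X; have [n0|] := posnP n.
  have noI (i : 'I_n) : False by have := leq_ltn_trans (leq0n i) (ltn_ord i); move: n0 => ->.
  have -> : A *m X = 0 by apply/matrixP => i; have := noI i.
  by rewrite nsq0 mulr_ge0 ?nsq_ge0 ?sqr_ge0.
move=> n0; have [mu Amu [w w0 AAw]] := symmetric_norm_attained n0.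
have mu0 : 0 <= mu.
  have wp : 0 < nsq w by rewrite lt_neqAle nsq_ge0 andbT eq_sym nsq_eq0.
  by rewrite -(pmulr_lge0 _ wp); exact: le_trans (nsq_ge0 _) (Amu w).
have mu_sigma : mu <= sigma ^+ 2.
  rewrite -[mu]sqr_sqrtr// -[X in X <= _]real_normK ?num_real//.
  rewrite ler_pXn2r ?nnegrE//; set r := Num.sqrt mu.
  have rr : r * r = mu by rewrite -expr2 sqr_sqrtr.
  have [z0|z0] := eqVneq (A *m w + r *: w) 0.
    rewrite -normrN; apply: (eig _ w) => //.
    by apply/eqP; rewrite scaleNr -addr_eq0 z0.
  apply: (eig _ (A *m w + r *: w)) => //.
  by rewrite mulmxDr AAw -scalemxAr scalerDr scalerA rr addrC.
rewrite [nsq (_ *m _)]nsq_col [nsq X]nsq_col mulr_sumr; apply: ler_sum => j _.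
have -> : col j (A *m X) = A *m col j X by rewrite !colE mulmxA.
exact: le_trans (Amu _) (ler_wpM2r (nsq_ge0 _) mu_sigma).
Qed.

End SymmetricOperatorNorm.

(** * The averaging projection *)

Definition avgmx (R : realType) (n : nat) : 'M[R]_n :=
  n%:R^-1 *: ((const_mx 1 : 'cV[R]_n) *m (const_mx 1 : 'cV[R]_n)^T).

Section Averaging.
Variables (R : realType) (n : nat).
Hypothesis n_gt0 : (0 < n)%N.
Local Notation J := (avgmx R n).

Lemma avgmxE i j : J i j = n%:R^-1.
Proof. by rewrite !mxE big_ord1 !mxE !mulr1. Qed.

Lemma avgmx_tr : J^T = J.
Proof. by apply/matrixP => i j; rewrite mxE !avgmxE. Qed.

Lemma mulmx_avgmx (A : 'M[R]_n) : (forall i, \sum_j A i j = 1) -> A *m J = J.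
Proof.
move=> A1; apply/matrixP => i j; rewrite mxE avgmxE.
by under eq_bigr do rewrite avgmxE; rewrite -mulr_suml A1 mul1r.
Qed.

Lemma avgmx_mulmx (A : 'M[R]_n) : (forall j, \sum_i A i j = 1) -> J *m A = J.
Proof.
move=> A1; rewrite -[LHS]trmxK trmx_mul avgmx_tr mulmx_avgmx ?avgmx_tr// => i.
by rewrite -[RHS](A1 i); apply: eq_bigr => j _; rewrite mxE.
Qed.

Lemma avgmx_idem : J *m J = J.
Proof.
apply: mulmx_avgmx => i; under eq_bigr do rewrite avgmxE.
by rewrite sumr_const card_ord -[LHS]mulr_natl mulfV// pnatr_eq0 -lt0n.
Qed.

(** Pythagoras: [J] is symmetric and idempotent, hence an orthogonal projection. *)
Lemma nsq_avgmx p (X : 'M[R]_(n, p)) :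
  nsq X = nsq (J *m X) + nsq (X - J *m X).
Proof.
rewrite nsqB [dot X _]dotC dot_mulmxl avgmx_tr /nsq.
by rewrite [dot (J *m X) _]dot_mulmxl avgmx_tr mulmxA avgmx_idem dotC; ring.
Qed.

Lemma nsq_avgmx_le p (X : 'M[R]_(n, p)) : nsq (J *m X) <= nsq X.
Proof. by rewrite [leRHS]nsq_avgmx lerDl nsq_ge0. Qed.

Lemma nsq_dev_le p (X : 'M[R]_(n, p)) : nsq (X - J *m X) <= nsq X.
Proof. by rewrite [leRHS]nsq_avgmx lerDr nsq_ge0. Qed.

End Averaging.

(** * Spectral gap of the mixing matrix *)

Section Mixing.
Variables (R : realType) (n : nat) (e : rel 'I_n) (W : 'M[R]_n) (sigma : R).
Hypothesis e_connected : connected_graph e.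
Hypothesis W_mixing : mixing_matrix e W.
Hypothesis W_sigma : second_eigenvalue_magnitude W sigma.
Hypothesis sigma_lt1 : sigma < 1.
Local Notation J := (avgmx R n).

Lemma second_eigenvalue_dim_gt0 : (0 < n)%N.
Proof.
have [s [Ws _ s1 _]] := W_sigma.
have := congr1 (fun q : {poly R} => size q) Ws.
by rewrite size_char_poly size_prod_XsubC => -[->]; exact: ltn_trans s1.
Qed.

Lemma second_eigenvalue_ge0 : 0 <= sigma.
Proof. by have [s [_ _ _ ->]] := W_sigma; exact: normr_ge0. Qed.

(* Maximum principle: the set where [w] is maximal is closed under neighbours. *)
Lemma harmonic_const (w : 'cV[R]_n) : W *m w = w -> forall i j, w i 0 = w j 0.
Proof.
have [Wsym [W_ge0 W_row _] W_nbh] := W_mixing; have [e_sym e_conn] := e_connected.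
move=> Ww.
suff [m w_m] : exists m, forall i, w i 0 = m by move=> i j; rewrite !w_m.
pose i0 := Ordinal second_eigenvalue_dim_gt0.
have [i1 _ i1_max] := @arg_maxP _ _ _ i0 xpredT (fun i => w i 0) isT.
exists (w i1 0) => i.
have step j k : w j 0 = w i1 0 -> e j k -> w k 0 = w i1 0.
  move=> wj ejk.
  have sum0 : \sum_l W j l * (w i1 0 - w l 0) == 0.
    under eq_bigr do rewrite mulrBr; rewrite sumrB -mulr_suml W_row mul1r.
    by rewrite -wj -[X in X - _ == _](congr1 (fun u : 'cV_n => u j 0) Ww) mxE subrr.
  move: sum0; rewrite psumr_eq0; last first.
    by move=> l _; rewrite mulr_ge0 ?subr_ge0 ?W_ge0//; exact: i1_max.
  move=> /allP/(_ k (mem_index_enum k)) /=; rewrite mulf_eq0 subr_eq0.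
  have /gt_eqF-> /= : 0 < W j k by apply: (W_nbh j k).1; rewrite /nbh ejk orbT.
  by move=> /eqP.
have /connectP[q] := e_conn i1 i.
elim/last_ind: q i => [|q k IH] i /=; first by move=> _ ->.
rewrite rcons_path last_rcons => /andP[eq ek] ->.
exact: step (IH _ eq erefl) ek.
Qed.

(** For a nonzero eigenvalue of [W - J] the eigenvector is annihilated by [J], so it is one of [W]
    as well. Subtracting [J] removes the consensus eigenvalue 1, which heads the list [s]; the tail
    has moduli at most [sigma]. *)
Lemma eigenvalue_dev (a : R) (w : 'cV[R]_n) :
  w != 0 -> (W - J) *m w = a *: w -> `|a| <= sigma.
Proof.
have [Wsym [W_ge0 W_row W_col] _] := W_mixing.
move=> w0 aw; have [->|a0] := eqVneq a 0.
  by rewrite normr0 second_eigenvalue_ge0.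
have n_gt0 := second_eigenvalue_dim_gt0.
have Jw : J *m w = 0.
  apply/eqP; have := congr1 (mulmx J) aw.
  rewrite mulmxA mulmxBr avgmx_mulmx// avgmx_idem// subrr mul0mx -scalemxAr.
  by move=> /esym/eqP; rewrite scaler_eq0 (negbTE a0).
have Ww : W *m w = a *: w by rewrite -aw mulmxBl Jw subr0.
have [s [Ws s_sorted s1 sigmaE]] := W_sigma.
have eig_s (b : R) (u : 'cV[R]_n) : u != 0 -> W *m u = b *: u -> b \in s.
  move=> u0 bu; rewrite -root_prod_XsubC -Ws -eigenvalue_root_char.
  apply/eigenvalueP; exists u^T; last by rewrite -(trmx0 _) (inj_eq trmx_inj).
  by rewrite -[X in _ *m X]Wsym -trmx_mul bu linearZ.
case: s Ws s_sorted s1 sigmaE eig_s => [//|b0 [//|b1 s]] _ /= /andP[_ s_path] _.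
move=> sigmaE eig_s.
have tail_le b : b \in b1 :: s -> `|b| <= sigma.
  rewrite sigmaE inE => /predU1P[->//|bs].
  have geT : transitive (fun a b : R => `|b| <= `|a|).
    by move=> x y z yx zx; exact: le_trans zx yx.
  exact: (allP (order_path_min geT s_path) b bs).
have [i0] : exists i, w i 0 != 0.
  apply/existsP; apply: contraNT w0; rewrite negb_exists => /forallP w0.
  apply/eqP/matrixP => i j; rewrite ord1 !mxE; apply/eqP.
  by have := w0 i; rewrite negbK.
(* Constant vectors give the eigenvalue 1, which cannot lie in the tail because [sigma < 1]. *)
move=> wi0; have b0E : b0 = 1.
  pose u := const_mx 1 : 'cV[R]_n.
  have : 1 \in [:: b0, b1 & s].
    apply: (eig_s _ u).
      by apply/eqP => /matrixP/(_ i0 0)/eqP; rewrite !mxE oner_eq0.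
    apply/matrixP => i j; rewrite scale1r !mxE -[RHS](W_row i).
    by apply: eq_bigr => k _; rewrite mxE mulr1.
  rewrite inE => /predU1P[->//|/tail_le].
  by rewrite normr1 leNgt sigma_lt1.
have := eig_s _ _ w0 Ww; rewrite inE => /predU1P[ab0|/tail_le//].
(* If [a] is the head 1, the maximum principle makes [w] constant, and [J *m w = 0] then contradicts
   [w != 0]. *)
have wc : forall i j, w i 0 = w j 0.
  by apply: harmonic_const; rewrite Ww ab0 b0E scale1r.
have := congr1 (fun u : 'cV_n => u i0 0) Jw; rewrite !mxE => Jwi0.
move: wi0 Jwi0; under eq_bigr do rewrite avgmxE (wc _ i0).
rewrite sumr_const card_ord -mulrnAl -[X in X * _]mulr_natl mulfV ?pnatr_eq0 -?lt0n//.
by rewrite mul1r => /[swap] ->; rewrite eqxx.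
Qed.

Lemma mixing_power_avgmx k : W ^+ k *m J = J /\ J *m W ^+ k = J.
Proof.
have [_ [_ W_row W_col] _] := W_mixing.
elim: k => [|k [IHl IHr]]; first by rewrite expr0 mulmx1 mul1mx.
rewrite {1}exprS exprSr -!mulmxE -mulmxA IHl mulmxA IHr.
by rewrite mulmx_avgmx// avgmx_mulmx.
Qed.

(** W^(k+1) X - J X is [W - J] applied to W^k X - J X, so each round gains a factor [sigma ^+ 2] in
    squared norm. *)
Lemma mixing_contraction k p (X : 'M[R]_(n, p)) :
  nsq (W ^+ k *m X - J *m X) <= sigma ^+ (2 * k) * nsq (X - J *m X).
Proof.
have [Wsym [_ W_row W_col] _] := W_mixing.
have n_gt0 := second_eigenvalue_dim_gt0.
elim: k => [|k IH]; first by rewrite expr0 mul1mx muln0 expr0 mul1r.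
have -> : W ^+ k.+1 *m X - J *m X = (W - J) *m (W ^+ k *m X - J *m X).
  rewrite mulmxBl !mulmxBr exprS -mulmxE !mulmxA mulmx_avgmx// avgmx_idem//.
  by rewrite (mixing_power_avgmx k).2 subrr subr0.
have symm : (W - J)^T = W - J by rewrite linearB /= Wsym avgmx_tr.
apply: le_trans (symmetric_norm_le_eigenvalue symm _ eigenvalue_dev _) _.
  exact: second_eigenvalue_ge0.
rewrite mulnS exprD -mulrA; apply: ler_wpM2l => //.
by rewrite sqr_ge0.
Qed.

End Mixing.

(** * Stacked vectors as n x p matrices *)

Section Unstack.
Variables (R : realType) (n p : nat).
Implicit Types u v : 'cV[R]_(n * p).

(** Node vectors become rows, so that a Kronecker product with the identity acts as left
    multiplication and the Euclidean norm becomes the Frobenius norm. *)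
Definition unstack u : 'M[R]_(n, p) := \matrix_(i, j) u (mxtens_index (i, j)) 0.

Lemma row_unstack u i : (row i (unstack u))^T = block u i.
Proof. by apply/matrixP => j k; rewrite ord1 !mxE. Qed.

Lemma unstackB u v : unstack (u - v) = unstack u - unstack v.
Proof. by apply/matrixP => i j; rewrite !mxE. Qed.

Lemma sum_mxtens_index (F : 'I_(n * p) -> R) :
  \sum_k F k = \sum_i \sum_j F (mxtens_index (i, j)).
Proof.
rewrite pair_bigA /= (reindex (@mxtens_index n p)) /=; last first.
  by exists (@mxtens_unindex n p) => k _; [exact: mxtens_indexK|exact: mxtens_unindexK].
by apply: eq_bigr => -[].
Qed.

Lemma nsq_unstack u : nsq (unstack u) = nsq u.
Proof.
rewrite !nsqE sum_mxtens_index; apply: eq_bigr => i _.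
by apply: eq_bigr => j _; rewrite big_ord1 mxE.
Qed.

Lemma unstack_tens (A : 'M[R]_n) u :
  unstack (A *t (1%:M : 'M[R]_p) *m u) = A *m unstack u.
Proof.
apply/matrixP => i j; rewrite !mxE sum_mxtens_index.
apply: eq_bigr => k _; rewrite (bigD1 j)//= big1 ?addr0 => [|l lj].
  by rewrite tensmxE !mxE eqxx mulr1.
by rewrite tensmxE !mxE eq_sym (negbTE lj) mulr0 mul0r.
Qed.

Lemma unstack_Wmx (A : 'M[R]_n) k u :
  unstack (Wmx p A ^+ k *m u) = A ^+ k *m unstack u.
Proof.
elim: k => [|k IH]; first by rewrite !expr0 !mul1mx.
by rewrite !exprS -!mulmxE -!mulmxA unstack_tens IH.
Qed.

Lemma unstack_Mmx u : unstack (Mmx R n p *m u) = avgmx R n *m unstack u.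
Proof. exact: unstack_tens. Qed.

End Unstack.

(** * Descent lemma for a Lipschitz gradient *)

Section DescentLemma.
Variables (R : realType) (p : nat) (L : R) (f : 'cV[R]_p -> R).
Hypothesis L_ge0 : 0 <= L.
Hypothesis f_C1 : C1 f.
Hypothesis f_lip : grad_lipschitz L f.

Lemma derive_grad (z v : 'cV[R]_p) : 'D_v f z = dot (grad f z) v.
Proof.
have df := f_C1.1 z.
rewrite deriveE// {1}(matrix_sum_delta v) linear_sum /= dotE.
apply: eq_bigr => i _; rewrite !big_ord1 linearZ /= !mxE -deriveE//.
by rewrite mulrC.
Qed.

Lemma is_derive_along (z v : 'cV[R]_p) (t : R) :
  is_derive t 1 (fun s : R => f (z + s *: v)) ('D_v f (z + t *: v)).
Proof.
have := (diff_derivable (f := f) (a := z + t *: v) (v := v)) (f_C1.1 _).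
have E : (fun h : R => h^-1 *: ((f \o shift (z + t *: v)) (h *: v) - f (z + t *: v)))
  = (fun h : R => h^-1 *:
       (((fun s : R => f (z + s *: v)) \o shift t) (h *: (1 : R)) - f (z + t *: v))).
  apply/funext => h /=; congr (_ *: (f _ - _)).
  by rewrite scalerDl scaler1 addrCA addrA.
by rewrite /derivable E => df; split=> //; rewrite /derive E.
Qed.

(** By the mean value theorem on the segment, it suffices that the gradient at the intermediate
    point differs from that at [x] by at most L |y - x|. This yields the constant [L] in place of
    the sharp L / 2. *)
Lemma descent_lemma (x y : 'cV[R]_p) :
  f y <= f x + dot (grad f x) (y - x) + L * nsq (y - x).
Proof.
set d := y - x.
have der t := is_derive_along x d t.
have cont : {within `[0 : R, 1], continuous (fun s : R => f (x + s *: d))}.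
  apply: derivable_within_continuous => t _.
  by have := der t => -[].
have [t] := @MVT R (fun s => f (x + s *: d)) (fun s => 'D_d f (x + s *: d)) 0 1
  ltr01 (fun t _ => der t) cont.
rewrite in_itv /= => /andP[t0 t1].
rewrite scale1r scale0r addr0 subr0 mulr1 derive_grad.
have -> : x + d = y by rewrite /d addrC subrK.
move=> /eqP; rewrite subr_eq => /eqP ->.
suff : dot (grad f (x + t *: d) - grad f x) d <= L * nsq d.
  by rewrite dotDl dotNl; lra.
apply: le_trans (cauchy_schwarz _ _) _.
rewrite -enorm_sqr expr2 mulrA ler_wpM2r ?enorm_ge0//.
apply: le_trans (f_lip _ _) _; rewrite addrAC subrr add0r enormZ.
by rewrite ler_wpM2l// ler_piMl ?enorm_ge0// ger0_norm ?ltW.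
Qed.

End DescentLemma.

(** * Scaling matrices and the local phase at one node *)

Lemma scaling_matrixP (R : realType) p (psi Psi : R) (H : 'M[R]_p)
    (u : 'cV[R]_p) :
  scaling_matrix psi Psi H ->
  psi * nsq u <= dot u (H *m u) /\ dot u (H *m u) <= Psi * nsq u.
Proof.
have E (B : 'M[R]_p) : (u^T *m B *m u) 0 0 = dot u (B *m u).
  by rewrite /dot mulmxA [in RHS]/mxtrace big_ord1.
move=> [_ /(_ u) + /(_ u)]; rewrite !E !mulmxBl !mul_scalar_mx.
rewrite !dotDr !dotNr !dotZr !subr_ge0.
by [].
Qed.

(** Cauchy-Schwarz in the form [H] for [H *m u] and [u] gives |H u|^4 <= Psi |H u|^2 Psi |u|^2;
    divide by |H u|^2. *)
Lemma scaling_matrix_enorm (R : realType) p (psi Psi : R) (H : 'M[R]_p)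
    (u : 'cV[R]_p) : 0 <= psi -> psi <= Psi ->
  scaling_matrix psi Psi H -> enorm (H *m u) <= Psi * enorm u.
Proof.
move=> psi0 psiPsi sH; have [Hsym _ _] := sH.
have Psi0 := le_trans psi0 psiPsi.
have Hpos (w : 'cV[R]_p) : 0 <= dot w (H *m w).
  by apply: le_trans (scaling_matrixP w sH).1; rewrite mulr_ge0 ?nsq_ge0.
have [h0|h0] := leP (nsq (H *m u)) 0.
  rewrite -(@ler_pXn2r _ 2) ?nnegrE ?mulr_ge0 ?enorm_ge0// enorm_sqr.
  by rewrite (le_trans h0)// sqr_ge0.
have := psd_cauchy_schwarz (H *m u) u Hsym Hpos; rewrite -/(nsq _) => cs.
rewrite -(@ler_pXn2r _ 2) ?nnegrE ?mulr_ge0 ?enorm_ge0// exprMn !enorm_sqr.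
rewrite -(ler_pM2l h0) -expr2; apply: le_trans cs _.
have -> : nsq (H *m u) * (Psi ^+ 2 * nsq u)
  = (Psi * nsq (H *m u)) * (Psi * nsq u) by ring.
by apply: ler_pM => //; exact: (scaling_matrixP _ sH).2.
Qed.

Section LocalPhase.
Variables (R : realType) (p K : nat) (L psi Psi a : R).
Variables (g : 'cV[R]_p -> 'cV[R]_p) (H : nat -> 'M[R]_p).
Variables (xs vs : nat -> 'cV[R]_p).
Hypothesis K_gt0 : (0 < K)%N.
Hypothesis L_ge0 : 0 <= L.
Hypothesis psi_ge0 : 0 <= psi.
Hypothesis psi_le : psi <= Psi.
Hypothesis a_ge0 : 0 <= a.
Hypothesis a_small : 2 * L * Psi * a <= 1.
Hypothesis g_lip : forall y z, enorm (g y - g z) <= L * enorm (y - z).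
Hypothesis H_scaling : forall k, (k < K)%N -> scaling_matrix psi Psi (H k).
Hypothesis xsS : forall k, (k < K)%N ->
  xs k.+1 = xs k - (a / K%:R) *: (H k *m vs k).
Hypothesis vsS : forall k, (k < K.-1)%N ->
  vs k.+1 = vs k + g (xs k.+1) - g (xs k).

(** The gradient increments telescope. Index [K] is excluded because the last tracker update of an
    outer iteration uses the gradient at the mixed point. *)
Lemma local_tracking k : (k < K)%N -> vs k = vs 0%N + g (xs k) - g (xs 0%N).
Proof.
elim: k => [|k IH] kK; first by rewrite addrK.
rewrite vsS; last by rewrite -ltnS prednK.
rewrite IH 1?ltnW// [LHS]addrAC [_ - _ - g (xs k)]addrAC addrK.
by rewrite addrAC.
Qed.

Let r := enorm (vs 0%N).

(** Both bounds are linear in k / K, hence uniform in [K]. A drift of at most 2 Psi a r keeps the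
    tracker within 2 L Psi a r of [vs 0%N], so its norm is at most 2 r by [a_small]; this controls
    the next step. *)
Lemma local_drift_dot k : (k <= K)%N ->
  enorm (xs k - xs 0%N) <= k%:R * (a / K%:R * (2 * Psi * r)) /\
  k%:R * (a / K%:R * ((psi - 2 * L * Psi ^+ 2 * a) * r ^+ 2))
    <= dot (vs 0%N) (xs 0%N - xs k).
Proof.
have K0 : 0 < K%:R :> R by rewrite ltr0n.
have Psi0 := le_trans psi_ge0 psi_le.
have r0 : 0 <= r by exact: enorm_ge0.
have aK0 : 0 <= a / K%:R by rewrite divr_ge0// ltW.
elim: k => [|k IH] kK.
  by rewrite subrr dot0r !mul0r -(scale0r 0) enormZ normr0 mul0r.
have {IH}[IH1 IH2] := IH (ltnW kK).
have drift : enorm (xs k - xs 0%N) <= 2 * Psi * a * r.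
  apply: le_trans IH1 _; rewrite mulrA.
  have -> : 2 * Psi * a * r = a * (2 * Psi * r) by ring.
  apply: ler_wpM2r; first by rewrite !mulr_ge0.
  rewrite mulrCA ler_piMr// ler_pdivrMr// mul1r ler_nat.
  exact: ltnW.
have dv : enorm (vs k - vs 0%N) <= L * (2 * Psi * a * r).
  rewrite local_tracking// addrAC [_ + _ - vs 0%N]addrAC subrr add0r.
  by apply: le_trans (g_lip _ _) _; rewrite ler_wpM2l.
have vk : enorm (vs k) <= 2 * r.
  have -> : vs k = vs 0%N + (vs k - vs 0%N) by rewrite addrC subrK.
  apply: le_trans (enormD _ _) _; rewrite -/r.
  by have := ler_wpM2r r0 a_small; lra.
have sH := H_scaling kK.
rewrite xsS// -[k.+1]addn1 natrD ![(k%:R + _) * _]mulrDl !mul1r; split.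
  rewrite addrAC; apply: le_trans (enormD _ _) _; apply: lerD => //.
  rewrite -scaleNr enormZ normrN ger0_norm// ler_wpM2l//.
  apply: le_trans (scaling_matrix_enorm _ psi_ge0 psi_le sH) _.
  by rewrite [2 * _]mulrC -mulrA ler_wpM2l.
rewrite opprB addrCA addrC dotDr; apply: lerD => //.
rewrite dotZr ler_wpM2l//.
have -> : H k *m vs k = H k *m vs 0%N + H k *m (vs k - vs 0%N).
  by rewrite -mulmxDr [_ + (_ - _)]addrC subrK.
rewrite dotDr.
have h1 := (scaling_matrixP (vs 0%N) sH).1.
have h2 : - dot (vs 0%N) (H k *m (vs k - vs 0%N)) <= r * (Psi * (L * (2 * Psi * a * r))).
  rewrite -dotNr -mulmxN; apply: le_trans (cauchy_schwarz _ _) _.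
  rewrite ler_wpM2l//; apply: le_trans (scaling_matrix_enorm _ psi_ge0 psi_le sH) _.
  by rewrite ler_wpM2l// -scaleN1r enormZ normrN1 mul1r.
by rewrite /r !enorm_sqr in h2 *; rewrite -/r in h2; move: h1 h2; rewrite -enorm_sqr -/r; lra.
Qed.

Lemma local_phase : 4 * L * Psi ^+ 2 * a <= psi ->
  nsq (xs 0%N - xs K) <= 4 * a ^+ 2 * Psi ^+ 2 * nsq (vs 0%N) /\
  a * psi / 2 * nsq (vs 0%N) <= dot (vs 0%N) (xs 0%N - xs K).
Proof.
move=> a_small'; have [h1 h2] := local_drift_dot (leqnn K).
have K0 : K%:R != 0 :> R by rewrite pnatr_eq0 -lt0n.
have Psi0 := le_trans psi_ge0 psi_le.
have aK : K%:R * (a / K%:R) = a by rewrite mulrC divfK.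
rewrite mulrA aK in h1; rewrite mulrA aK in h2; split.
  rewrite -opprB nsqN -!enorm_sqr -/r.
  have -> : 4 * a ^+ 2 * Psi ^+ 2 * r ^+ 2 = (a * (2 * Psi * r)) ^+ 2 by ring.
  by rewrite ler_pXn2r ?nnegrE ?enorm_ge0// !mulr_ge0 ?enorm_ge0.
(* The extra smallness gives psi - 2 L Psi^2 a >= psi / 2. *)
apply: le_trans h2; rewrite -enorm_sqr -/r -2!mulrA; apply: ler_wpM2l => //.
by rewrite mulrA; apply: ler_wpM2r; [exact: sqr_ge0|lra].
Qed.

End LocalPhase.

(** * Descent of the averaged objective and the scalar energy balance *)

Definition avg (R : realType) n p (X : 'M[R]_(n, p)) : 'cV[R]_p :=
  n%:R^-1 *: \sum_i (row i X)^T.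

Definition gradmx (R : realType) n p (f : 'I_n -> 'cV[R]_p -> R)
    (X : 'M[R]_(n, p)) : 'M[R]_(n, p) :=
  \matrix_i (grad (f i) (row i X)^T)^T.

Section Objective.
Variables (R : realType) (n p : nat) (L : R) (f : 'I_n -> 'cV[R]_p -> R).
Hypothesis L_ge0 : 0 <= L.
Hypothesis f_C1 : forall i, C1 (f i).
Hypothesis f_lip : forall i, grad_lipschitz L (f i).
Local Notation J := (avgmx R n).
Implicit Types X Y : 'M[R]_(n, p).

Lemma row_avg X i : (row i (J *m X))^T = avg X.
Proof.
apply/matrixP => j k; rewrite !mxE summxE mulr_sumr.
by apply: eq_bigr => l _; rewrite avgmxE !mxE.
Qed.

Lemma gradmx_lip X Y : nsq (gradmx f X - gradmx f Y) <= L ^+ 2 * nsq (X - Y).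
Proof.
rewrite /nsq !dot_row mulr_sumr; apply: ler_sum => i _.
rewrite -!/(nsq _) -!enorm_sqr -exprMn.
rewrite ler_pXn2r ?nnegrE ?mulr_ge0 ?enorm_ge0//.
rewrite !linearB /= !rowK !trmxK; exact: f_lip.
Qed.

(** The descent lemma is applied to every [f i] between the same two averages, the rows of [J *m X]
    and [J *m Y]; symmetry of [J] regroups the sum. *)
Lemma objective_descent X Y :
  objective f (avg Y) <= objective f (avg X)
    + n%:R^-1 * (dot (J *m gradmx f (J *m X)) (Y - X) + L * nsq (J *m (Y - X))).
Proof.
rewrite /objective -mulrDr ler_wpM2l ?invr_ge0//.
rewrite dot_mulmxl avgmx_tr mulmxBr /nsq !dot_row mulr_sumr.
rewrite -!big_split; apply: ler_sum => i _ /=.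
rewrite -/(nsq _) rowK trmxK !linearB /= !row_avg addrA.
exact: descent_lemma.
Qed.

End Objective.

(** Here [v], [q], [d], [S] stand for |V|^2, |V - J V|^2, |X - J X|^2 and the squared local step;
    primes mark the next iterate. Each net decrease is halved: one half absorbs error terms, the
    other survives as a coefficient of the residual. *)
Lemma potential_decrease (R : realType) (a psi Psi L s n v q d S F F' q' d' c : R) :
  0 < a -> 0 < psi -> 0 < Psi -> 0 < L -> 0 < s -> s < 1 -> 1 <= n ->
  c = (1 - s) ^+ 2 / (16 * (1 + s) * L ^+ 2) ->
  0 <= v -> 0 <= q -> 0 <= d -> 0 <= S ->
  S <= 4 * a ^+ 2 * Psi ^+ 2 * v ->
  F' <= F + n^-1 * (- (a * psi / 2 * v)
     + (8 * a * Psi ^+ 2 / psi * q + (4 * (8 * a * Psi ^+ 2 / psi))^-1 * S)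
     + (8 * a * Psi ^+ 2 / psi * (L ^+ 2 * d)
        + (4 * (8 * a * Psi ^+ 2 / psi))^-1 * S)
     + L * S) ->
  d' <= (1 + s) / 2 * d + s * (1 + s) / (1 - s) * S ->
  q' <= (1 + s) / 2 * q + s * (1 + s) / (1 - s) * (L ^+ 2 * (8 * d + 8 * S)) ->
  32 * L * Psi ^+ 2 * a <= psi ->
  192 * n * Psi ^+ 2 * a <= psi * (1 - s) ->
  32 * Psi ^+ 2 * a <= psi * (c * (1 - s)) ->
  32 * Psi ^+ 2 * L ^+ 2 * a <= psi * (1 - s) ^+ 2 ->
  F' + d' + c * q' + (a * psi / (16 * n) * v + c * (1 - s) / 4 * q
     + (1 - s) ^+ 2 / 4 * d) <= F + d + c * q.
Proof.
move=> a0 psi0 Psi0 L0 s0 s1 n1 cE v0 q0 d0 S0 Sv hF hd hq t1 t2 t3 t4.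
have n0 : 0 < n by apply: lt_le_trans n1.
have s1' : 0 < 1 - s by rewrite subr_gt0.
have s2 : 0 < 1 + s by rewrite addr_gt0.
have c0 : 0 < c.
  by rewrite cE divr_gt0 ?exprn_gt0// pmulr_lgt0 ?exprn_gt0//; lra.
(* Young's parameter [k] is chosen so that [(4 k)^-1 * 4 a^2 Psi^2 = a psi / 8]. *)
set k := 8 * a * Psi ^+ 2 / psi in hF.
have k0 : 0 < k by rewrite /k divr_gt0// mulr_gt0 ?exprn_gt0// mulr_gt0.
have k_q : k <= c * (1 - s) / 4.
  by rewrite /k ler_pdivrMr//; lra.
have k_d : k * L ^+ 2 <= (1 - s) ^+ 2 / 4.
  by rewrite /k mulrAC ler_pdivrMr//; lra.
have kS : (4 * k)^-1 * S <= a * psi / 8 * v.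
  apply: le_trans (ler_wpM2l _ Sv) _.
    by rewrite invr_ge0 mulr_ge0// ltW.
  rewrite le_eqVlt; apply/orP; left; apply/eqP; rewrite /k; field.
  by rewrite !gt_eqF.
have LS : L * S <= a * psi / 8 * v.
  apply: le_trans (ler_wpM2l (ltW L0) Sv) _.
  have := ler_wpM2l (mulr_ge0 (ltW a0) v0) t1.
  by lra.
(* The three terms in [S] cost a psi / 8 each out of a psi / 2. On the consensus terms [n^-1] is
   simply bounded by 1. *)
have hF' : F' <= F - a * psi / (8 * n) * v + k * q + k * L ^+ 2 * d.
  apply: le_trans hF _; rewrite -!addrA lerD2l.
  have n1' : n^-1 <= 1 by rewrite invf_le1.
  have kqd : 0 <= k * q + k * L ^+ 2 * d.
    apply: addr_ge0; first exact: mulr_ge0 (ltW k0) q0.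
    exact: mulr_ge0 (mulr_ge0 (ltW k0) (sqr_ge0 _)) d0.
  apply: le_trans (_ : n^-1 * (- (a * psi / 8 * v)
                               + (k * q + k * L ^+ 2 * d)) <= _).
    by rewrite ler_pM2l ?invr_gt0//; lra.
  rewrite mulrDr; apply: lerD; last by rewrite ler_piMl.
  by rewrite le_eqVlt; apply/orP; left; apply/eqP; field; rewrite gt_eqF.
have hd' : d' <= (1 + s) / 2 * d + 2 / (1 - s) * S.
  apply: le_trans hd _; rewrite lerD2l ler_wpM2r// ler_wpM2r ?invr_ge0 ?ltW//.
  nra.
(* The weight [c] turns the coupling 8 L^2 s (1 + s) / (1 - s) into s (1 - s) / 2, so the gap (1 -
   s) / 2 of [d] still leaves (1 - s)^2 / 2. *)
have hq' : c * q' <= c * (1 + s) / 2 * q + s * (1 - s) / 2 * d + 1 * S.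
  apply: le_trans (ler_wpM2l (ltW c0) hq) _.
  apply: le_trans (_ : c * (1 + s) / 2 * q + s * (1 - s) / 2 * (d + S) <= _).
    rewrite le_eqVlt; apply/orP; left; apply/eqP; rewrite cE; field.
    by rewrite !gt_eqF.
  by rewrite [_ * (d + S)]mulrDr addrA lerD2l ler_wpM2r//; nra.
(* Since 2 / (1 - s) + 1 <= 3 / (1 - s), the factor needed in [t2] is 3 * 4 * 16 = 192. *)
have hS : (2 / (1 - s) + 1) * S <= a * psi / (16 * n) * v.
  apply: le_trans (_ : 3 / (1 - s) * S <= _).
    rewrite ler_wpM2r// -lerBrDl -mulrBl ler_pdivlMr//; lra.
  apply: le_trans (ler_wpM2l _ Sv) _; first by rewrite ltW ?divr_gt0.
  rewrite mulrA ler_wpM2r// -subr_ge0.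
  have -> : a * psi / (16 * n) - 3 / (1 - s) * (4 * a ^+ 2 * Psi ^+ 2)
      = a / (16 * n * (1 - s)) * (psi * (1 - s) - 192 * n * Psi ^+ 2 * a).
    by field; rewrite !gt_eqF.
  by rewrite mulr_ge0 ?subr_ge0// divr_ge0 ?mulr_ge0// ltW.
have vn : a * psi / (8 * n) * v = 2 * (a * psi / (16 * n) * v).
  by field; rewrite gt_eqF.
have hkq := ler_wpM2r q0 k_q.
have hkd := ler_wpM2r d0 k_d.
rewrite vn in hF'.
move: hF' hd' hq' hS hkq hkd; set A := a * psi / (16 * n) * v.
set B := 2 / (1 - s); set kL := k * L ^+ 2.
lra.
Qed.

(** * One outer iteration in matrix form *)

Section OneStep.
Variables (R : realType) (n p : nat) (f : 'I_n -> 'cV[R]_p -> R).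
Variables (L s psi Psi a : R) (W : 'M[R]_n).
Local Notation J := (avgmx R n).
Hypothesis n_gt0 : (0 < n)%N.
Hypothesis L_gt0 : 0 < L.
Hypothesis s_gt0 : 0 < s.
Hypothesis s_lt1 : s < 1.
Hypothesis psi_gt0 : 0 < psi.
Hypothesis Psi_gt0 : 0 < Psi.
Hypothesis a_gt0 : 0 < a.
Hypothesis f_C1 : forall i, C1 (f i).
Hypothesis f_lip : forall i, grad_lipschitz L (f i).
Hypothesis JW : J *m W = J.
Hypothesis W_contraction : forall X : 'M[R]_(n, p),
  nsq (W *m X - J *m X) <= s * nsq (X - J *m X).

Definition tracker_weight := (1 - s) ^+ 2 / (16 * (1 + s) * L ^+ 2).

Hypothesis small1 : 32 * L * Psi ^+ 2 * a <= psi.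
Hypothesis small2 : 192 * n%:R * Psi ^+ 2 * a <= psi * (1 - s).
Hypothesis small3 : 32 * Psi ^+ 2 * a <= psi * (tracker_weight * (1 - s)).
Hypothesis small4 : 32 * Psi ^+ 2 * L ^+ 2 * a <= psi * (1 - s) ^+ 2.

Definition matrix_potential (X V : 'M[R]_(n, p)) : R :=
  objective f (avg X) + nsq (X - J *m X) + tracker_weight * nsq (V - J *m V).

(** The parameter eta = (1 - s) / (2 s) solves s (1 + eta) = (1 + s) / 2: half of the contraction
    gap is given up to absorb the perturbation [Y]. *)
Lemma dev_contraction (X Y : 'M[R]_(n, p)) :
  nsq (W *m (X + Y) - J *m (W *m (X + Y))) <=
    (1 + s) / 2 * nsq (X - J *m X) + s * (1 + s) / (1 - s) * nsq Y.
Proof.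
have s1' : 0 < 1 - s by rewrite subr_gt0.
rewrite mulmxA JW; apply: le_trans (W_contraction _) _.
have -> : X + Y - J *m (X + Y) = (X - J *m X) + (Y - J *m Y).
  by rewrite mulmxDr opprD addrACA.
have eta0 : 0 < (1 - s) / (2 * s) by rewrite divr_gt0 ?mulr_gt0.
apply: le_trans (ler_wpM2l (ltW s_gt0) (nsqD_le _ _ eta0)) _.
rewrite mulrDr !mulrA; apply: lerD.
  by rewrite le_eqVlt; apply/orP; left; apply/eqP; field; rewrite gt_eqF.
have -> : s * (1 + ((1 - s) / (2 * s))^-1) = s * (1 + s) / (1 - s).
  by field; rewrite !gt_eqF.
apply: ler_wpM2l; last exact: nsq_dev_le.
by rewrite ltW// divr_gt0// mulr_gt0// addr_gt0.
Qed.

(** Write W (X - S) - X = (W X - J X) - (X - J X) - W S, where the first two terms are consensus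
    errors. *)
Lemma iterate_move_le (X S : 'M[R]_(n, p)) :
  nsq (W *m (X - S) - X) <= 8 * nsq (X - J *m X) + 8 * nsq S.
Proof.
have two (A B : 'M[R]_(n, p)) : nsq (A - B) <= 2 * nsq A + 2 * nsq B.
  have := nsqD_le A (- B) ltr01; rewrite nsqN invr1.
  by have -> : 1 + 1 = 2 :> R by ring.
set Y := X - J *m X.
have E : W *m (X - S) - X = (W *m X - J *m X - Y) - W *m S.
  by rewrite /Y opprB addrA addrNK mulmxBr addrAC.
have hX := le_trans (W_contraction X) (ler_piMl (nsq_ge0 _) (ltW s_lt1)).
have hS := le_trans (W_contraction S) (ler_piMl (nsq_ge0 _) (ltW s_lt1)).
(* Contraction is available for deviations only, so [W *m S] is split through [J *m S]. *)
have hWS : nsq (W *m S) <= 4 * nsq S.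
  have -> : W *m S = (W *m S - J *m S) - (- (J *m S)) by rewrite opprK subrK.
  apply: le_trans (two _ _) _; rewrite nsqN.
  by have := nsq_avgmx_le n_gt0 S; have := nsq_dev_le n_gt0 S; lra.
rewrite E; apply: le_trans (two _ _) _.
by have := two (W *m X - J *m X) Y; rewrite -/Y in hX; lra.
Qed.

(** The invariant [J *m V = J *m gradmx f X] survives mixing, and it is what relates a step along
    [V] to the gradient of the averaged objective. *)
Lemma one_step (X V S : 'M[R]_(n, p)) (X' := W *m (X - S))
    (V' := W *m (V + gradmx f X' - gradmx f X)) :
  J *m V = J *m gradmx f X ->
  nsq S <= 4 * a ^+ 2 * Psi ^+ 2 * nsq V ->
  a * psi / 2 * nsq V <= dot V S ->
  J *m V' = J *m gradmx f X' /\
  matrix_potential X' V' + (a * psi / (16 * n%:R) * nsq V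
    + tracker_weight * (1 - s) / 4 * nsq (V - J *m V)
    + (1 - s) ^+ 2 / 4 * nsq (X - J *m X)) <= matrix_potential X V.
Proof.
move=> JV SV dotVS; split.
  by rewrite mulmxA JW !mulmxBr mulmxDr JV addrAC subrr add0r.
have k0 : 0 < 8 * a * Psi ^+ 2 / psi by rewrite !mulr_gt0 ?invr_gt0.
have JX' : J *m (X' - X) = - (J *m S).
  by rewrite mulmxBr mulmxA JW mulmxBr addrAC subrr add0r.
apply: (@potential_decrease _ a psi Psi L s n%:R _ _ _ (nsq S)) => //;
  rewrite ?nsq_ge0 ?ler1n//.
- apply: le_trans (objective_descent (ltW L_gt0) f_C1 f_lip X X') _.
  rewrite lerD2l ler_wpM2l ?invr_ge0// JX' nsqN; apply: lerD; last first.
    by rewrite ler_wpM2l ?(ltW L_gt0)// nsq_avgmx_le.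
  have -> : dot (J *m gradmx f (J *m X)) (X' - X)
      = - dot (J *m gradmx f (J *m X)) S.
    by rewrite !dot_mulmxl avgmx_tr JX' dotNr.
  (* The averaged gradient at consensus is [V] minus two errors: the tracker disagreement and [D],
     which the Lipschitz bound controls by the consensus error of [X]. *)
  set D := J *m (gradmx f X - gradmx f (J *m X)).
  have -> : J *m gradmx f (J *m X) = V - (V - J *m V) - D.
    by rewrite /D mulmxBr -JV !opprB [V + _]addrC subrK addrC subrK.
  rewrite !dotDl !dotNl !opprD !opprK; apply: lerD; first apply: lerD.
  + by rewrite lerN2.
  + exact: young.
  + apply: le_trans (young _ _ k0) _; rewrite lerD2r ler_pM2l//.
    apply: le_trans (nsq_avgmx_le n_gt0 _) _.
    exact: gradmx_lip (ltW L_gt0) f_lip _ _.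
- by apply: le_trans (dev_contraction _ _) _; rewrite nsqN.
- rewrite /V' -addrA; apply: le_trans (dev_contraction _ _) _.
  rewrite lerD2l ler_wpM2l//.
    by rewrite ltW// divr_gt0 ?subr_gt0// mulr_gt0// addr_gt0.
  apply: le_trans (gradmx_lip (ltW L_gt0) f_lip _ _) _.
  by rewrite ler_wpM2l ?sqr_ge0//; exact: iterate_move_le.
Qed.

End OneStep.

(** * Telescoping a sufficient decrease *)

Section SufficientDecrease.
Variables (R : realType) (r P : nat -> R) (c lo : R).
Hypothesis c_gt0 : 0 < c.
Hypothesis decrease : forall t, P t.+1 + c * r t <= P t.
Hypothesis P_ge : forall t, lo <= P t.

Lemma sum_decrease T : c * \sum_(0 <= t < T) r t <= P 0%N - lo.
Proof.
apply: le_trans (_ : P 0%N - P T <= _); last by rewrite lerB.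
elim: T => [|T IH]; first by rewrite big_nil mulr0 subrr.
by rewrite big_nat_recr//= mulrDr; have := decrease T; lra.
Qed.

(** The minimum is at most the average. As [T] is positive, the default [r 0%N] is one of the terms
    and does not alter the minimum. *)
Lemma min_le_decrease T : (0 < T)%N ->
  \big[Num.min/r 0%N]_(0 <= t < T) r t <= (P 0%N - lo) / (c * T%:R).
Proof.
move=> T0; rewrite ler_pdivlMr; last by rewrite mulr_gt0 ?ltr0n.
apply: le_trans (sum_decrease T); rewrite mulrCA ler_wpM2l ?(ltW c_gt0)//.
rewrite mulr_natr -[T in _ *+ T]subn0 -sumr_const_nat.
rewrite big_nat [leRHS]big_nat; apply: ler_sum => t tT.
by apply: (bigmin_inf_seq _ t); rewrite ?mem_index_iota.
Qed.

(** While the residual exceeds [delta], each iteration uses up more than [c * delta] of the budget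
    [P 0%N - lo]. This limits any such initial stretch, hence yields both the existence and the size
    of the first index. *)
Lemma first_reach_decrease delta : 0 < delta ->
  exists2 N, first_reach r delta N & N%:R <= (P 0%N - lo) / c / delta.
Proof.
move=> delta0.
have above N : (forall t, (t < N)%N -> delta < r t) ->
    N%:R <= (P 0%N - lo) / c / delta.
  move=> above; rewrite !ler_pdivlMr// mulrC.
  apply: le_trans (sum_decrease N); rewrite ler_wpM2l ?(ltW c_gt0)//.
  rewrite mulr_natl -[N in _ *+ N]subn0 -sumr_const_nat.
  rewrite big_nat [leRHS]big_nat; apply: ler_sum => t tN.
  exact/ltW/above.
have reached : exists t, r t <= delta.
  apply: contrapT => none.
  have /above : forall t, (t < (Num.truncn ((P 0%N - lo) / c / delta)).+1)%N ->
      delta < r t.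
    by move=> t _; rewrite ltNge; apply/negP => rt; apply: none; exists t.
  by apply/negP; rewrite -ltNge truncnS_gt.
have [N rN N_min] := find_ex_minn reached.
have N_above t : (t < N)%N -> delta < r t.
  by rewrite ltnNge ltNge; apply: contraNN => /N_min.
by exists N; [split|exact: above].
Qed.

End SufficientDecrease.

(** * From a run of the scheme to the matrix recursion *)

Section Run.
Variables (R : realType) (n p Kc Kg : nat) (L sigma psi Psi a : R).
Variables (f : 'I_n -> 'cV[R]_p -> R) (e : rel 'I_n) (Wt : 'M[R]_n).
Variables (H : nat -> nat -> 'I_n -> 'M[R]_p) (x0 : 'cV[R]_(n * p)).
Variables (x v : nat -> 'cV[R]_(n * p)) (xl vl : nat -> nat -> 'cV[R]_(n * p)).
Local Notation J := (avgmx R n).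
Local Notation s := (sigma ^+ (2 * Kc)).
Local Notation X t := (unstack (x t)).
Local Notation V t := (unstack (v t)).
Hypothesis L_gt0 : 0 < L.
Hypothesis sigma_gt0 : 0 < sigma.
Hypothesis sigma_lt1 : sigma < 1.
Hypothesis Kc_gt0 : (0 < Kc)%N.
Hypothesis psi_gt0 : 0 < psi.
Hypothesis psi_le : psi <= Psi.
Hypothesis a_gt0 : 0 < a.
Hypothesis f_C1 : forall i, C1 (f i).
Hypothesis f_lip : forall i, grad_lipschitz L (f i).
Hypothesis e_connected : connected_graph e.
Hypothesis Wt_mixing : mixing_matrix e Wt.
Hypothesis Wt_sigma : second_eigenvalue_magnitude Wt sigma.
Hypothesis Kg_gt0 : (0 < Kg)%N.
Hypothesis H_scaling : forall t k i, (k < Kg)%N -> scaling_matrix psi Psi (H t k i).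
Hypothesis run : fixed_update_run f Wt Kg Kc (a / Kg%:R) H x0 x v xl vl.
Hypothesis small1 : 32 * L * Psi ^+ 2 * a <= psi.
Hypothesis small2 : 192 * n%:R * Psi ^+ 2 * a <= psi * (1 - s).
Hypothesis small3 : 32 * Psi ^+ 2 * a <= psi * (tracker_weight L s * (1 - s)).
Hypothesis small4 : 32 * Psi ^+ 2 * L ^+ 2 * a <= psi * (1 - s) ^+ 2.

Let Psi_gt0 : 0 < Psi. Proof. exact: lt_le_trans psi_le. Qed.

Let small_drift : 2 * L * Psi * a <= 1.
Proof.
rewrite -(ler_pM2r Psi_gt0) mul1r; apply: le_trans psi_le.
apply: le_trans small1.
have : 0 <= L * Psi ^+ 2 * a by rewrite !mulr_ge0 ?sqr_ge0// ltW.
by lra.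
Qed.

Lemma unstack_rows (u : 'cV[R]_(n * p)) (M : 'M[R]_(n, p)) :
  (forall i, block u i = (row i M)^T) -> unstack u = M.
Proof.
by move=> uM; apply/row_matrixP => i; apply/trmx_inj; rewrite row_unstack.
Qed.

Lemma run_inner_tracking t k i : (k < Kg)%N ->
  block (vl t k) i =
  block (v t) i + grad (f i) (block (xl t k) i) - grad (f i) (block (x t) i).
Proof.
move=> kK; rewrite -(run_vl0 run t) -(run_xl0 run t).
apply: (local_tracking (K := Kg) (g := grad (f i))
  (xs := fun k => block (xl t k) i) (vs := fun k => block (vl t k) i)) => //.
by move=> l lK; exact: run_vl run t l i lK.
Qed.

(** All inner gradients cancel: tracking holds up to index [Kg.-1], and the last correction
    subtracts the gradient there and adds the one at the mixed iterate. *)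
Lemma run_update t (S := X t - unstack (xl t Kg)) :
  X t.+1 = Wt ^+ Kc *m (X t - S) /\
  V t.+1 = Wt ^+ Kc *m (V t + gradmx f (X t.+1) - gradmx f (X t)).
Proof.
split; first by rewrite (run_x run) unstack_Wmx /S opprB addrC subrK.
rewrite (run_v run) unstack_Wmx; congr (_ *m _).
apply: unstack_rows => i; rewrite (run_vlK run) run_inner_tracking ?ltn_predL//.
have -> : (row i (V t + gradmx f (X t.+1) - gradmx f (X t)))^T
    = block (v t) i + grad (f i) (block (x t.+1) i) - grad (f i) (block (x t) i).
  by rewrite !(raddfB, raddfD) /= !rowK !trmxK !row_unstack.
by rewrite addrAC [_ - _ - grad (f i) (block (xl t Kg.-1) i)]addrAC addrK addrAC.
Qed.

(** The bounds of [local_phase] have the same constants at every node, so they add up over the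
    rows. *)
Lemma run_inner t (S := X t - unstack (xl t Kg)) :
  nsq S <= 4 * a ^+ 2 * Psi ^+ 2 * nsq (V t) /\
  a * psi / 2 * nsq (V t) <= dot (V t) S.
Proof.
have node i : nsq (row i S)^T <= 4 * a ^+ 2 * Psi ^+ 2 * nsq (row i (V t))^T /\
    a * psi / 2 * nsq (row i (V t))^T <= dot (row i (V t))^T (row i S)^T.
  rewrite /S !linearB /= !row_unstack -(run_xl0 run t) -(run_vl0 run t).
  apply: (@local_phase _ p Kg L psi Psi a (grad (f i)) (fun k => H t k i)
    (fun k => block (xl t k) i) (fun k => block (vl t k) i)) => //.
  - exact: ltW.
  - exact: ltW.
  - exact: ltW.
  - exact: f_lip.
  - by move=> k kK; exact: H_scaling.
  - by move=> k kK; exact: run_xl run t k i kK.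
  - by move=> k kK; exact: run_vl run t k i kK.
  - apply: le_trans small1.
    have : 0 <= L * Psi ^+ 2 * a by rewrite !mulr_ge0 ?sqr_ge0// ltW.
    by lra.
rewrite {1}/nsq [nsq (V t)]/nsq !dot_row !mulr_sumr.
by split; apply: ler_sum => i _; have [] := node i.
Qed.

Lemma potential_matrix_potential (y w : 'cV[R]_(n * p)) :
  potential f L sigma Kc y w = matrix_potential f L s (unstack y) (unstack w).
Proof.
rewrite /potential /matrix_potential !enorm_sqr -!nsq_unstack !unstackB !unstack_Mmx.
congr (objective f _ + _ + _); congr (_ *: _).
by apply: eq_bigr => i _; rewrite row_unstack.
Qed.

Lemma residual_unstack (y w : 'cV[R]_(n * p)) :
  residual y w = nsq (unstack w) + nsq (unstack w - J *m unstack w)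
                 + nsq (unstack y - J *m unstack y).
Proof.
by rewrite /residual !enorm_sqr -!nsq_unstack !unstackB !unstack_Mmx.
Qed.

(** The smallest of the three residual coefficients of [one_step]; it is free of [Kg]. *)
Definition decrease_rate : R :=
  Num.min (a * psi / (16 * n%:R))
    (Num.min (tracker_weight L s * (1 - s) / 4) ((1 - s) ^+ 2 / 4)).

Let s_gt0 : 0 < s. Proof. exact: exprn_gt0. Qed.

Let s_lt1 : s < 1.
Proof. by rewrite exprn_ilt1 ?ltW// -lt0n muln_gt0. Qed.

Lemma tracker_weight_gt0 : 0 < tracker_weight L s.
Proof.
rewrite divr_gt0 ?exprn_gt0 ?subr_gt0// pmulr_lgt0 ?exprn_gt0//.
by rewrite pmulr_rgt0// addr_gt0.
Qed.

Lemma decrease_rate_gt0 : 0 < decrease_rate.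
Proof.
have n_gt0 := second_eigenvalue_dim_gt0 Wt_sigma.
rewrite /decrease_rate !lt_min; apply/and3P; split.
- by rewrite divr_gt0 ?mulr_gt0 ?ltr0n.
- by rewrite divr_gt0// mulr_gt0 ?tracker_weight_gt0// subr_gt0.
- by rewrite divr_gt0// exprn_gt0// subr_gt0.
Qed.

Lemma run_decrease t : J *m V t = J *m gradmx f (X t) /\
  potential f L sigma Kc (x t.+1) (v t.+1) + decrease_rate * residual (x t) (v t)
    <= potential f L sigma Kc (x t) (v t).
Proof.
have n_gt0 := second_eigenvalue_dim_gt0 Wt_sigma.
have [_ JW] := mixing_power_avgmx Wt_mixing Kc.
have contr (Y : 'M[R]_(n, p)) : nsq (Wt ^+ Kc *m Y - J *m Y) <= s * nsq (Y - J *m Y).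
  exact: (mixing_contraction e_connected Wt_mixing Wt_sigma sigma_lt1).
have step u : J *m V u = J *m gradmx f (X u) ->
    J *m V u.+1 = J *m gradmx f (X u.+1) /\
    matrix_potential f L s (X u.+1) (V u.+1) + (a * psi / (16 * n%:R) * nsq (V u)
      + tracker_weight L s * (1 - s) / 4 * nsq (V u - J *m V u)
      + (1 - s) ^+ 2 / 4 * nsq (X u - J *m X u)) <= matrix_potential f L s (X u) (V u).
  move=> JV; have [Su dotu] := run_inner u.
  have [XE VE] := run_update u; rewrite VE XE.
  exact: (one_step n_gt0 L_gt0 s_gt0 s_lt1 psi_gt0 Psi_gt0 a_gt0 f_C1 f_lip
    JW contr small1 small2 small3 small4 JV Su dotu).
(* At the start the trackers equal the local gradients even before averaging. *)
have track : forall u, J *m V u = J *m gradmx f (X u).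
  elim=> [|u /step[]//]; congr (_ *m _); apply: unstack_rows => i.
  by rewrite (run_v0 run) rowK trmxK row_unstack.
split; first exact: track.
have [_] := step t (track t); rewrite !potential_matrix_potential residual_unstack.
apply: le_trans; rewrite lerD2l ![decrease_rate * _]mulrDr.
have [r1 r2 r3] : [/\ decrease_rate <= a * psi / (16 * n%:R),
    decrease_rate <= tracker_weight L s * (1 - s) / 4 &
    decrease_rate <= (1 - s) ^+ 2 / 4].
  by split; rewrite /decrease_rate !ge_min lexx ?orbT.
by apply: lerD; [apply: lerD|]; rewrite ler_wpM2r ?nsq_ge0.
Qed.

End Run.

(** * Lower bound of the potential and complexity estimates *)

Lemma potential_ge_inf (R : realType) (n p Kc : nat) (L sigma : R)
    (f : 'I_n -> 'cV[R]_p -> R) (x v : 'cV[R]_(n * p)) :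
  0 <= sigma -> has_lbound (range (objective f)) ->
  inf (range (objective f)) <= potential f L sigma Kc x v.
Proof.
move=> sigma0 F_lb; rewrite /potential -addrA.
apply: le_trans (_ : objective f (mean x) <= _).
  by apply: ge_inf => //; exists (mean x).
rewrite lerDl addr_ge0 ?sqr_ge0// mulr_ge0 ?sqr_ge0// divr_ge0 ?sqr_ge0//.
by rewrite mulr_ge0 ?sqr_ge0// mulr_ge0// addr_ge0// exprn_ge0.
Qed.

(** Expressing the initial trackers through [x0] lets the complexity constants be chosen before [Kg]
    and the run. *)
Definition initial_tracker (R : realType) (n p : nat)
    (f : 'I_n -> 'cV[R]_p -> R) (x0 : 'cV[R]_(n * p)) : 'cV[R]_(n * p) :=
  \col_k grad (f (mxtens_unindex k).1) (block x0 (mxtens_unindex k).1)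
    (mxtens_unindex k).2 0.

Lemma initial_trackerE (R : realType) (n p : nat) (f : 'I_n -> 'cV[R]_p -> R)
    (x0 v : 'cV[R]_(n * p)) :
  (forall i, block v i = grad (f i) (block x0 i)) -> v = initial_tracker f x0.
Proof.
move=> vE; apply/matrixP => k j; rewrite ord1 [RHS]mxE -vE mxE.
by rewrite -surjective_pairing mxtens_unindexK.
Qed.

Theorem corollary3p6 (R : realType) (n Kc : nat) (L sigma psi Psi : R)
    (L_gt0 : 0 < L) (sigma_gt0 : 0 < sigma) (sigma_lt1 : sigma < 1)
    (Kc_ge1 : (1 <= Kc)%N) (psi_gt0 : 0 < psi) (psi_le_Psi : psi <= Psi) :
  exists2 abar_max : R, 0 < abar_max &
  forall (abar : R) (abar_gt0 : 0 < abar) (abar_le : abar <= abar_max)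
    (p : nat) (f : 'I_n -> 'cV[R]_p -> R)
    (f_C1 : forall i, C1 (f i))
    (F_bounded_below : has_lbound (range (objective f)))
    (f_lip : forall i, grad_lipschitz L (f i))
    (e : rel 'I_n) (e_connected : connected_graph e)
    (Wt : 'M[R]_n) (Wt_mixing : mixing_matrix e Wt)
    (Wt_sigma : second_eigenvalue_magnitude Wt sigma),
  let Finf := inf (range (objective f)) in
  exists2 c0 : R, 0 < c0 &
  forall x0 : 'cV[R]_(n * p),
    (forall (Kg : nat) (Kg_ge1 : (1 <= Kg)%N)
       (H : nat -> nat -> 'I_n -> 'M[R]_p)
       (H_scaling : forall t k i, (k < Kg)%N -> scaling_matrix psi Psi (H t k i))
       (x v : nat -> 'cV[R]_(n * p)) (xl vl : nat -> nat -> 'cV[R]_(n * p))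
       (run : fixed_update_run f Wt Kg Kc (abar / Kg%:R) H x0 x v xl vl)
       (T : nat) (T_ge1 : (1 <= T)%N),
     \big[Num.min/residual (x 0%N) (v 0%N)]_(0 <= t < T) residual (x t) (v t)
       <= (potential f L sigma Kc (x 0%N) (v 0%N) - Finf) / (c0 * T%:R))
    /\
    (exists CG CC : R, [/\ 0 < CG, 0 < CC &
     forall (Kg : nat) (Kg_ge1 : (1 <= Kg)%N)
       (H : nat -> nat -> 'I_n -> 'M[R]_p)
       (H_scaling : forall t k i, (k < Kg)%N -> scaling_matrix psi Psi (H t k i))
       (x v : nat -> 'cV[R]_(n * p)) (xl vl : nat -> nat -> 'cV[R]_(n * p))
       (run : fixed_update_run f Wt Kg Kc (abar / Kg%:R) H x0 x v xl vl)
       (delta : R) (delta_gt0 : 0 < delta),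
     exists2 N : nat,
       first_reach (fun t => residual (x t) (v t)) delta N &
       (gradient_evaluations n Kg N)%:R <= CG * ((n * Kg)%:R / delta) /\
       (communication_rounds Kc N)%:R <= CC * (Kc%:R / delta)]).
Proof.
set s := sigma ^+ (2 * Kc).
have Psi_gt0 : 0 < Psi by exact: lt_le_trans psi_le_Psi.
have s_gt0 : 0 < s by exact: exprn_gt0.
have s1 : 0 < 1 - s by rewrite subr_gt0 exprn_ilt1 ?ltW// -lt0n muln_gt0.
have c_gt0 := tracker_weight_gt0 L_gt0 sigma_gt0 sigma_lt1 Kc_ge1; rewrite -/s in c_gt0.
(* [n.+1] keeps the divisor [b2] positive at a point where [0 < n] is not yet known. *)
pose b1 := 32 * L * Psi ^+ 2; pose b2 := 192 * n.+1%:R * Psi ^+ 2.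
pose b3 := 32 * Psi ^+ 2; pose b4 := 32 * Psi ^+ 2 * L ^+ 2.
have b1_gt0 : 0 < b1 by rewrite mulr_gt0 ?exprn_gt0// mulr_gt0.
have b2_gt0 : 0 < b2 by rewrite mulr_gt0 ?exprn_gt0// mulr_gt0 ?ltr0n.
have b3_gt0 : 0 < b3 by rewrite mulr_gt0 ?exprn_gt0.
have b4_gt0 : 0 < b4 by rewrite mulr_gt0 ?exprn_gt0.
exists (Num.min (Num.min (psi / b1) (psi * (1 - s) / b2))
          (Num.min (psi * (tracker_weight L s * (1 - s)) / b3) (psi * (1 - s) ^+ 2 / b4))).
  rewrite !lt_min; apply/andP; split; apply/andP; split;
    apply: divr_gt0 => //; apply: mulr_gt0 => //; last exact: exprn_gt0.
  exact: mulr_gt0.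
move=> a a_gt0; rewrite !le_min !ler_pdivlMr// => /andP[/andP[a1 a2] /andP[a3 a4]].
rewrite mulrC in a1; rewrite mulrC in a3; rewrite mulrC in a4.
have {}a2 : 192 * n%:R * Psi ^+ 2 * a <= psi * (1 - s).
  apply: le_trans a2; rewrite [leRHS]mulrC ler_pM2r// /b2 ler_pM2r ?exprn_gt0//.
  by rewrite ler_pM2l// ler_nat.
move=> p f f_C1 F_lb f_lip e e_conn Wt Wt_mix Wt_sig Finf.
have rate_gt0 := decrease_rate_gt0 (L := L) (psi := psi) (a := a) L_gt0
  sigma_gt0 sigma_lt1 Kc_ge1 psi_gt0 a_gt0 Wt_sig.
(* The rate is fixed before [x0], [Kg] and the run are introduced. *)
set c0 := decrease_rate n Kc L sigma psi a in rate_gt0.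
have pot_ge x v : Finf <= potential f L sigma Kc x v.
  by apply: potential_ge_inf => //; exact: ltW.
have decrease x0 Kg (Kg_ge1 : (1 <= Kg)%N) H H_scaling x v xl vl
    (run : fixed_update_run f Wt Kg Kc (a / Kg%:R) H x0 x v xl vl) t :=
  (run_decrease L_gt0 sigma_gt0 sigma_lt1 Kc_ge1 psi_gt0 psi_le_Psi a_gt0
    f_C1 f_lip e_conn Wt_mix Wt_sig Kg_ge1 H_scaling run a1 a2 a3 a4 t).2.
exists c0 => // x0; split.
  move=> Kg Kg_ge1 H H_scaling x v xl vl run T T_ge1.
  exact: (@min_le_decrease _ (fun t => residual (x t) (v t))
    (fun t => potential f L sigma Kc (x t) (v t)) c0 Finf rate_gt0
    (decrease _ _ Kg_ge1 _ H_scaling _ _ _ _ run) (fun t => pot_ge _ _)).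
pose D := (potential f L sigma Kc x0 (initial_tracker f x0) - Finf) / c0.
have D_ge0 : 0 <= D by rewrite divr_ge0 ?subr_ge0// ltW.
have D_gt0 : 0 < D + 1 by rewrite ltr_wpDl.
(* [D] may vanish, hence the added 1. One constant serves both counts, which are [N] times [n * Kg]
   and [N] times [Kc]. *)
exists (D + 1), (D + 1); split=> // Kg Kg_ge1 H H_scaling x v xl vl run delta delta_gt0.
have [N NP N_le] := @first_reach_decrease _ (fun t => residual (x t) (v t))
    (fun t => potential f L sigma Kc (x t) (v t)) c0 Finf rate_gt0
    (decrease _ _ Kg_ge1 _ H_scaling _ _ _ _ run) (fun t => pot_ge _ _) _ delta_gt0.
exists N => //.
have {}N_le : N%:R <= (D + 1) / delta.
  apply: le_trans N_le _; rewrite (run_x0 run).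
  have -> : v 0%N = initial_tracker f x0.
    by apply: initial_trackerE => i; rewrite (run_v0 run) (run_x0 run).
  by rewrite ler_pM2r ?invr_gt0// lerDl.
by split; rewrite /gradient_evaluations /communication_rounds natrM
  [leRHS]mulrCA [leRHS]mulrC ler_wpM2r.
Qed.
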